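(* Let the polynomials $R_i(x;\boldsymbol\rho)$ and the modified data $(\overline x,\overline{\boldsymbol\rho})$ be chosen such that $\lambda_{x,\boldsymbol\rho}=\zeta\lambda_{\overline x,\overline{\boldsymbol\rho}}-\xi$ for parameters $\zeta,\xi$. Then there are coefficients $\lambda^+_{x,\boldsymbol\rho}$ (independent of $i$) and $\Phi^{0,+}_i,\Phi^{-1,+}_i$ (independent of $x$), with $\Phi^{-1,+}_0=0$ and $\Phi^{0,+}_0\neq0$, such that $$\lambda^+_{x,\boldsymbol\rho}R_{i}(x;\boldsymbol\rho)=\Phi_{i}^{0,+}R_{i}(\overline x;\overline{\boldsymbol\rho}) +\Phi_{i}^{-1,+}R_{i-1}(\overline x;\overline{\boldsymbol\rho}),\qquad i\ge 0,$$ if and only if, up to a global normalization, the coefficients are $$\lambda^+_{x,\boldsymbol\rho}=1,\qquad \Phi_{i}^{0,+}=\zeta^i\prod_{k=0}^{i-1}\frac{A_{k,\overline{\boldsymbol\rho}}}{A_{k,\boldsymbol\rho}}\ (i\ge0),\qquad \Phi_{i}^{-1,+}=\zeta^{-i+1}\left(1-\frac{\zeta A_{0,\overline{\boldsymbol\rho}}+\xi}{A_{0,\boldsymbol\rho}}\right)\prod_{k=1}^{i-1}\frac{C_{k+1,\boldsymbol\rho}}{C_{k,\overline{\boldsymbol\rho}}}\ (i\ge1),$$ and the constraints $(\mathfrak C_{A_2})$ are satisfied.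
   Context: $R_i(x;\boldsymbol\rho)$, $i=0,1,\dots,N$, denotes the polynomials of a finite family of the ($q$-)Askey scheme; $\boldsymbol\rho$ is the list of parameters, which includes the non-negative integer $N$. $R_i(x;\boldsymbol\rho)$ is a polynomial of degree $i$ in the variable $\lambda_{x,\boldsymbol\rho}$, normalized by $R_0(x;\boldsymbol\rho)=R_i(0;\boldsymbol\rho)=1$, and satisfies $$\lambda_{x,\boldsymbol\rho}R_i(x;\boldsymbol\rho)=A_{i,\boldsymbol\rho}R_{i+1}(x;\boldsymbol\rho)-(A_{i,\boldsymbol\rho}+C_{i,\boldsymbol\rho})R_i(x;\boldsymbol\rho)+C_{i,\boldsymbol\rho}R_{i-1}(x;\boldsymbol\rho),\qquad C_{0,\boldsymbol\rho}=0,\ A_{N,\boldsymbol\rho}=0.$$ $\overline{\boldsymbol\rho}$ is a list of modified parameters (of the same family) and $\overline x=x+\eta$ with $\eta\in\{0,+1,-1\}$. Notation: $X_{i,\boldsymbol\rho}:=A_{i-1,\boldsymbol\rho}C_{i,\boldsymbol\rho}$, $Y_{i,\boldsymbol\rho}:=-(A_{i,\boldsymbol\rho}+C_{i,\boldsymbol\rho})$, with $X_{0,\boldsymbol\rho}=0$. Parameters are generic, so that the denominators which occur do not vanish. The constraints $(\mathfrak C_{A_2})$: the two expressions $$\zeta^{2i}\frac{\zeta Y_{i,\overline{\boldsymbol\rho}}-Y_{i,\boldsymbol\rho}-\xi}{X_{i+1,\boldsymbol\rho}-\zeta^2X_{i,\overline{\boldsymbol\rho}}}\prod_{k=1}^{i}\frac{X_{k,\overline{\boldsymbol\rho}}}{X_{k,\boldsymbol\rho}},\qquad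 \zeta^{2i}\frac{X_{i+1,\boldsymbol\rho}-\zeta^{2}X_{i+1,\overline{\boldsymbol\rho}}}{(\zeta Y_{i,\overline{\boldsymbol\rho}}-Y_{i+1,\boldsymbol\rho}-\xi)X_{i+1,\boldsymbol\rho}}\prod_{k=1}^{i}\frac{X_{k,\overline{\boldsymbol\rho}}}{X_{k,\boldsymbol\rho}}$$ are equal and independent of $i$ for $i\ge0$.
   Formalization: x and x-bar range over the grids 0..N and 0..N-bar; it is assumed that N ≤ N-bar+1 and, with m the number of x-bar grid points not of the form x+η, that m=0 or 2m+2 ≤ N-bar; otherwise the claim fails (Krawtchouk, N=N-bar=1, η=1: relation holds, constraints do not). *)

(* Defs.v *)
From HB Require Import structures.
From mathcomp Require Import all_boot all_order all_algebra.

Set Implicit Arguments.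
Unset Strict Implicit.
Unset Printing Implicit Defensive.

Import Order.TTheory GRing.Theory Num.Theory.
Local Open Scope ring_scope.

(* A finite family of orthogonal polynomials of (q-)Askey type. [param] is the
   type of its admissible (generic) parameter lists rho; [size_of rho] is the
   integer N contained in rho.

   The polynomials R_i are given for 0 <= i <= N only: the values of [pol],
   [coefA] and [coefC] at indices > N are never constrained.

   Since A_N = 0, the three-term recurrence at i = N says that the grid
   lambda_0, ..., lambda_N is the spectrum of a finite Jacobi matrix. It can
   therefore only be required for x in {0, ..., N}. *)
Record finite_family (K : fieldType) := FiniteFamily {
  param : Type;
  size_of : param -> nat;
  lam : param -> int -> K;
  coefA : param -> nat -> K;
  coefC : param -> nat -> K;
  pol : param -> nat -> {poly K};
  pol_degree : forall rho i, (i <= size_of rho)%N -> size (pol rho i) = i.+1;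
  pol_0 : forall rho, pol rho 0 = 1;
  pol_at0 : forall rho i, (i <= size_of rho)%N -> (pol rho i).[lam rho 0] = 1;
  coefC_0 : forall rho, coefC rho 0 = 0;
  coefA_N : forall rho, coefA rho (size_of rho) = 0;
  (* At i = 0 the last term is 0 because C_0 = 0; at i = N the first one is 0
     because A_N = 0. *)
  pol_rec : forall rho i (x : int), (i <= size_of rho)%N ->
    0 <= x <= (size_of rho)%:Z ->
    lam rho x * (pol rho i).[lam rho x] =
      coefA rho i * (pol rho i.+1).[lam rho x]
      - (coefA rho i + coefC rho i) * (pol rho i).[lam rho x]
      + coefC rho i * (pol rho i.-1).[lam rho x];
  lam_inj : forall rho (x y : int), 0 <= x <= (size_of rho)%:Z ->
    0 <= y <= (size_of rho)%:Z -> lam rho x = lam rho y -> x = y;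
  coefAC_neq0 : forall rho i, (i < size_of rho)%N ->
    coefA rho i * coefC rho i.+1 != 0
}.

Section Contiguity.
Variables (K : fieldType) (F : finite_family K).
Implicit Types (rho rhob : param F) (eta x y : int) (zeta xi : K) (i : nat).

Definition Rpol rho i x : K := (pol rho i).[lam rho x].

Definition coefX rho i : K :=
  if i is j.+1 then coefA rho j * coefC rho j.+1 else 0.

Definition coefY rho i : K := - (coefA rho i + coefC rho i).

Definition grid rho : pred int := [pred x | 0 <= x <= (size_of rho)%:Z].

(* The x for which both R_i(x; rho) and R_i(x + eta; rhob) are taken on the
   grids where their recurrences hold. *)
Definition common_grid rho rhob eta : pred int :=
  [pred x | (x \in grid rho) && (x + eta \in grid rhob)].

(* Number of points of the grid of rhob not of the form x + eta with x in the
   grid of rho. If it is m, at most m independent linear relations hold between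
   the functions R_j(x + eta; rhob) on the common grid. When m > 0 and N-bar is
   too small, these spoil the comparison of coefficients: for Krawtchouk
   polynomials with N = N-bar = 1 and eta = 1 the contiguity relation can always
   be solved, but the constraints fail for generic p and p-bar. For
   2m + 2 <= N-bar the comparison of coefficients is legitimate. *)
Definition missing rho rhob eta : nat :=
  #|[set y : 'I_(size_of rhob).+1 | (y : nat)%:Z - eta \notin grid rho]|.

(* Coefficients of polynomials that do not belong to the family of rhob, namely
   R_{-1} and R_i with i > size_of rhob, are zero by convention. *)
Definition A2_contiguity rho rhob eta
    (lamp : int -> K) (Phi0 Phim : nat -> K) : Prop :=
  [/\ Phim 0 = 0,
      Phi0 0 != 0,
      forall i, (size_of rhob < i <= size_of rho)%N -> Phi0 i = 0 &
      forall i x, (i <= size_of rho)%N -> x \in common_grid rho rhob eta ->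
        lamp x * Rpol rho i x =
          Phi0 i * Rpol rhob i (x + eta) + Phim i * Rpol rhob i.-1 (x + eta)].

Definition A2_Phi0 rho rhob zeta i : K :=
  zeta ^+ i * \prod_(0 <= k < i) (coefA rhob k / coefA rho k).

(* For i = j + 1 >= 1 the power of zeta is -i + 1 = -j and the product runs over
   1 <= k <= i - 1 = j. *)
Definition A2_Phim rho rhob zeta xi i : K :=
  if i is j.+1 then
    zeta ^- j * (1 - (zeta * coefA rhob 0 + xi) / coefA rho 0)
    * \prod_(1 <= k < j.+1) (coefC rho k.+1 / coefC rhob k)
  else 0.

Definition A2_coefficients rho rhob eta zeta xi
    (lamp : int -> K) (Phi0 Phim : nat -> K) : Prop :=
  exists2 c : K, c != 0 &
    [/\ forall x, x \in common_grid rho rhob eta -> lamp x = c * 1,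
        forall i, (i <= size_of rho)%N -> Phi0 i = c * A2_Phi0 rho rhob zeta i &
        forall i, (i <= size_of rho)%N ->
          Phim i = c * A2_Phim rho rhob zeta xi i].

Definition A2_den1 rho rhob zeta i : K :=
  coefX rho i.+1 - zeta ^+ 2 * coefX rhob i.

Definition A2_den2 rho rhob zeta xi i : K :=
  zeta * coefY rhob i - coefY rho i.+1 - xi.

Definition A2_expr1 rho rhob zeta xi i : K :=
  zeta ^+ (2 * i)
  * ((zeta * coefY rhob i - coefY rho i - xi) / A2_den1 rho rhob zeta i)
  * \prod_(1 <= k < i.+1) (coefX rhob k / coefX rho k).

Definition A2_expr2 rho rhob zeta xi i : K :=
  zeta ^+ (2 * i)
  * ((coefX rho i.+1 - zeta ^+ 2 * coefX rhob i.+1)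
     / (A2_den2 rho rhob zeta xi i * coefX rho i.+1))
  * \prod_(1 <= k < i.+1) (coefX rhob k / coefX rho k).

(* The indices for which the two expressions make sense: the first involves
   Y_{i,rho} and the product X_{i,rhob} of data of rhob, hence i <= N and
   i <= N-bar (its denominator vanishes identically when N = 0); the second has
   X_{i+1,rho} as a denominator, hence i < N. *)
Definition A2_range1 rho rhob i : bool :=
  [&& 0 < size_of rho, i <= size_of rho & i <= size_of rhob]%N.

Definition A2_range2 rho i : bool := (i < size_of rho)%N.

Definition A2_generic rho rhob zeta xi : Prop :=
  (forall i, A2_range1 rho rhob i -> A2_den1 rho rhob zeta i != 0) /\
  (forall i, A2_range2 rho i -> A2_den2 rho rhob zeta xi i != 0).

Definition A2_constraints rho rhob zeta xi : Prop :=
  exists kappa : K,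
    (forall i, A2_range1 rho rhob i -> A2_expr1 rho rhob zeta xi i = kappa) /\
    (forall i, A2_range2 rho i -> A2_expr2 rho rhob zeta xi i = kappa).

End Contiguity.

(* Main.v *)
Require Import Defs.
From HB Require Import structures.
From mathcomp Require Import all_boot all_order all_algebra.
From mathcomp Require Import zify ring.

Set Implicit Arguments.
Unset Strict Implicit.
Unset Printing Implicit Defensive.

Import Order.TTheory GRing.Theory Num.Theory.
Local Open Scope ring_scope.

(** Write N, A, C, X, Y for the data of rho, N', a, c, x, y for those of rhob,
    R' for the polynomials of rhob, mu for their grid, and let m be the number
    [missing rho rhob eta]. The case i = 0 of the contiguity relation says that
    lambda^+ is the constant Phi0 0 on the common grid. Multiply the relation at
    i by lambda_x = zeta mu_(x + eta) - xi and expand both sides by the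
    three-term recurrences: this is a linear relation between R'_(i+1), R'_i,
    R'_(i-1) and R'_(i-2) on the common grid, and comparing coefficients gives
    the four equations [A2_relations].

    The comparison is legitimate ([Rpol_window_independent]). The common grid
    consists of N' + 1 - m nodes, hence R'_0, ..., R'_(N' - m) are independent
    there, by degree. So are R'_m, ..., R'_N': running the recurrence downwards
    from N', where a_N' = 0, gives R'_(N' - k) = q_k(mu) R'_N' on the grid with
    q_k of degree k, and R'_N' vanishes nowhere on the grid, since otherwise
    R'_0 = 1 would vanish too. The coefficients at indices outside 0, ..., N'
    vanish, and when m = 0 or 2m + 2 <= N', the part of each window of four
    consecutive indices inside 0, ..., N' lies in one of the two ranges.

    The first and fourth equations are first-order recurrences, and together
    with the second one at i = 0 they force the coefficients
    ([A2_relations_coefficients]). For these coefficients put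
    w_i = zeta^i prod_(1 <= k <= i) c_k / C_k and kappa = Phim_1 / C_1. Then
    Phim_(i+1) w_i = C_(i+1) kappa and Phim_i w_i = zeta c_i kappa, while
    Phi0_i w_i is the prefactor zeta^(2i) prod x_k / X_k of the two constrained
    expressions. Multiplied by w_i, the second equation at i says that the first
    expression is kappa ([A2_expr1P]), and the third equation at i + 1 that the
    second expression is kappa ([A2_expr2P]).

    Conversely, the equations at the indices i < N give the contiguity relation
    by induction on i, because A_i <> 0 for these i
    ([A2_relations_contiguity]). *)

(** * Linear independence of polynomial values *)

Section Independence.
Variable K : fieldType.

Lemma graded_comb_eq0 (g : nat -> {poly K}) (f : nat -> K) (n : nat) :
  (forall j, (j < n)%N -> size (g j) = j.+1) ->
  \sum_(0 <= j < n) f j *: g j = 0 -> forall j, (j < n)%N -> f j = 0.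
Proof.
elim: n => [//|n IHn] szg; rewrite big_nat_recr //= => sum0.
have fn0 : f n = 0.
  have /(congr1 (fun p : {poly K} => p`_n)) := sum0.
  rewrite coefD coef0 coefZ coef_sum big_nat big1 ?add0r; last first.
    by move=> j /andP[_ ltjn]; rewrite coefZ nth_default ?mulr0 // szg // ltnW.
  have -> : (g n)`_n = lead_coef (g n) by rewrite lead_coefE szg.
  move/eqP; rewrite mulf_eq0 lead_coef_eq0 -size_poly_eq0 szg // orbF.
  by move/eqP.
move: sum0; rewrite fn0 scale0r addr0 => sum0 j.
rewrite ltnS leq_eqVlt => /predU1P[-> //|]; apply: IHn => // k ltkn.
by apply: szg; rewrite ltnW.
Qed.

(** Polynomials g_0, ..., g_(n-1) with deg g_j = j stay independent as functions
    on n or more distinct nodes, also after multiplication by a function h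
    without zeros. *)
Lemma graded_values_independent (I : finType) (S : {set I}) (mu h : I -> K)
    (g : nat -> {poly K}) (f : nat -> K) (n : nat) :
  injective mu -> (forall y, y \in S -> h y != 0) -> (n <= #|S|)%N ->
  (forall j, (j < n)%N -> size (g j) = j.+1) ->
  (forall y, y \in S -> \sum_(0 <= j < n) f j * ((g j).[mu y] * h y) = 0) ->
  forall j, (j < n)%N -> f j = 0.
Proof.
move=> mu_inj h0 leS szg sum0.
suff p0 : \sum_(0 <= j < n) f j *: g j = 0 by exact: graded_comb_eq0 szg p0.
set p := \sum_(_ <= _ < _) _.
apply: (@roots_geq_poly_eq0 _ p [seq mu y | y <- enum S]).
- apply/allP=> z /mapP[y Sy ->] {z}; rewrite mem_enum in Sy.
  rewrite /root; have := sum0 _ Sy.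
  under eq_bigr do rewrite mulrA.
  rewrite -mulr_suml => /eqP; rewrite mulf_eq0 (negPf (h0 _ Sy)) orbF => /eqP s0.
  apply/eqP; rewrite -[RHS]s0 /p horner_sum.
  by apply: eq_bigr => j _; rewrite hornerZ.
- by rewrite map_inj_uniq ?enum_uniq.
- rewrite size_map -cardE; apply: leq_trans leS.
  rewrite /p big_nat; elim/big_ind: _; first by rewrite size_poly0.
    by move=> p1 p2 *; rewrite (leq_trans (size_polyD _ _)) // geq_max; apply/andP.
  move=> j /andP[_ ltjn]; apply: leq_trans (size_scale_leq _ _) _.
  by rewrite szg.
Qed.

Lemma sum_delta (u : nat -> K) (e : K) (k s t : nat) :
  (~~ (s <= k < t)%N -> e = 0) ->
  \sum_(s <= j < t) (e *+ (j == k)) * u j = e * u k.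
Proof.
case: (boolP (s <= k < t)%N) => [skt _|_ ->//]; last first.
  by rewrite mul0r big1 // => j _; rewrite mul0rn mul0r.
rewrite (bigD1_seq k) ?mem_index_iota ?iota_uniq //= eqxx mulr1n big1 ?addr0 //.
by move=> j /negPf ->; rewrite mulr0n mul0r.
Qed.

(** The indices of the window are i + 1, i, i - 1, i - 2. For i < 2 the truncated
    predecessors collide, and the corresponding coefficients are assumed to
    vanish. *)
Lemma window_coefs_eq0 (T : Type) (P : T -> Prop) (u : nat -> T -> K)
    (s t i : nat) (e1 e2 e3 e4 : K) :
  (forall f : nat -> K,
     (forall x, P x -> \sum_(s <= j < t) f j * u j x = 0) ->
     forall j, (s <= j < t)%N -> f j = 0) ->
  (~~ (s <= i.+1 < t)%N -> e1 = 0) -> (~~ (s <= i < t)%N -> e2 = 0) ->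
  (~~ (s <= i.-1 < t)%N -> e3 = 0) -> (~~ (s <= i.-2 < t)%N -> e4 = 0) ->
  ((i < 1)%N -> e3 = 0) -> ((i < 2)%N -> e4 = 0) ->
  (forall x, P x ->
     e1 * u i.+1 x + e2 * u i x + e3 * u i.-1 x + e4 * u i.-2 x = 0) ->
  [/\ e1 = 0, e2 = 0, e3 = 0 & e4 = 0].
Proof.
move=> indep out1 out2 out3 out4 low3 low4 rel.
pose f j := e1 *+ (j == i.+1) + e2 *+ (j == i)
  + e3 *+ (j == i.-1) + e4 *+ (j == i.-2).
have f0 : forall j, (s <= j < t)%N -> f j = 0.
  apply: indep => x Px; rewrite -[RHS](rel x Px).
  rewrite -(sum_delta (u^~ x) out1) -(sum_delta (u^~ x) out2).
  rewrite -(sum_delta (u^~ x) out3) -(sum_delta (u^~ x) out4) -!big_split /=.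
  by apply: eq_bigr => j _; rewrite !mulrDl.
have ne a b : a <> b :> nat -> (a == b) = false by move/eqP/negPf.
have z1 : e1 = 0.
  have [/f0|/out1//] := boolP (s <= i.+1 < t)%N.
  by rewrite /f eqxx !ne ?mulr0n ?addr0 //; clear; lia.
have z4 : e4 = 0.
  have [lt2|le2] := ltnP i 2; first exact: low4.
  have [/f0|/out4//] := boolP (s <= i.-2 < t)%N.
  by rewrite /f eqxx !ne ?mulr0n ?add0r //; move: le2; clear; case: i => [|[|i]] /=; lia.
have z3 : e3 = 0.
  have [lt1|le1] := ltnP i 1; first exact: low3.
  have [/f0|/out3//] := boolP (s <= i.-1 < t)%N.
  by rewrite /f z4 mul0rn eqxx !ne ?mulr0n ?add0r ?addr0 //; move: le1; clear; lia.
split=> //; have [/f0|/out2//] := boolP (s <= i < t)%N.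
by rewrite /f z1 z3 z4 eqxx !mul0rn add0r !addr0.
Qed.
End Independence.

(** * The recurrence run downwards *)

Section ReversedFamily.
Variables (K : fieldType) (F : finite_family K).
Implicit Types (rho : param F) (k : nat).

(** The polynomial q_k of degree k with R_(N - k) = q_k(lambda) R_N on the grid,
    obtained by solving the recurrence at the index N - k for R_(N - k - 1). *)
Fixpoint rev_pol rho k : {poly K} :=
  if k is k1.+1 then
    let j := (size_of rho - k1)%N in
    (Defs.coefC rho j)^-1 *:
      (('X + (coefA rho j + Defs.coefC rho j)%:P) * rev_pol rho k1
       - coefA rho j *: (if k1 is k2.+1 then rev_pol rho k2 else 0))
  else 1.

(** q_(k-1), with the convention q_(-1) = 0. *)
Definition rev_pol_pred rho k : {poly K} :=
  if k is k1.+1 then rev_pol rho k1 else 0.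

Lemma coefA_neq0 rho k : (k < size_of rho)%N -> coefA rho k != 0.
Proof. by move/coefAC_neq0; rewrite mulf_eq0 negb_or => /andP[]. Qed.

Lemma coefC_neq0 rho k : (0 < k <= size_of rho)%N -> Defs.coefC rho k != 0.
Proof.
by case: k => // k /coefAC_neq0; rewrite mulf_eq0 negb_or => /andP[].
Qed.

Lemma size_rev_pol rho k : (k <= size_of rho)%N -> size (rev_pol rho k) = k.+1.
Proof.
have szX (c : K) (p : {poly K}) n : size p = n.+1 ->
    size (('X + c%:P) * p) = n.+2.
  move=> szp; have p0 : p != 0 by rewrite -size_poly_eq0 szp.
  by rewrite size_proper_mul ?size_XaddC ?szp // lead_coefXaddC mul1r lead_coef_eq0.
suff: (k <= size_of rho)%N -> size (rev_pol rho k) = k.+1 /\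
   (size (rev_pol_pred rho k) <= k)%N.
  by move=> H /H[].
elim: k => [|k IHk] ltk; first by rewrite size_poly1 /= size_poly0.
have [szk szk1] := IHk (ltnW ltk).
split; last by rewrite /= szk.
rewrite [rev_pol _ _]/= -/(rev_pol_pred rho k).
rewrite size_scale ?invr_eq0 ?coefC_neq0 ?subn_gt0 ?ltk ?leq_subr //.
rewrite size_polyDl (szX _ _ _ szk) // size_polyN.
by apply: leq_ltn_trans (size_scale_leq _ _) _; rewrite ltnS ltnW.
Qed.

Lemma rev_pol_rec rho k (y : int) :
  (k <= size_of rho)%N -> 0 <= y <= (size_of rho)%:Z ->
  Rpol rho (size_of rho - k) y
  = (rev_pol rho k).[lam rho y] * Rpol rho (size_of rho) y.
Proof.
move=> lek gy; move: lek.
suff: (k <= size_of rho)%N ->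
   Rpol rho (size_of rho - k) y
     = (rev_pol rho k).[lam rho y] * Rpol rho (size_of rho) y /\
   coefA rho (size_of rho - k) * Rpol rho (size_of rho - k).+1 y
     = coefA rho (size_of rho - k)
       * ((rev_pol_pred rho k).[lam rho y]
          * Rpol rho (size_of rho) y).
  by move=> H /H[].
elim: k => [|k IHk] ltk; first by rewrite subn0 /= !hornerC mul1r coefA_N !mul0r.
have [Rk Rk1] := IHk (ltnW ltk).
have Ej : (size_of rho - k = (size_of rho - k.+1).+1)%N by lia.
have c0 : Defs.coefC rho (size_of rho - k) != 0.
  by apply: coefC_neq0; lia.
split; last by rewrite /= -Ej Rk.
have := pol_rec (leq_subr k (size_of rho)) gy.
rewrite -!/(Rpol _ _ _) Rk1 Rk -subnS => rec.
apply: (mulfI c0); rewrite [rev_pol _ _]/= -/(rev_pol_pred rho k).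
rewrite !(hornerZ, hornerD, hornerN, hornerM, hornerX, hornerC).
rewrite -[_^-1 * _ * _]mulrA mulVKf //.
move: rec; set X1 := (rev_pol rho k).[_]; set X2 := (rev_pol_pred rho k).[_].
set l := lam rho y; set a := coefA _ _; set c := Defs.coefC _ _.
set r := Rpol rho (size_of rho) y => rec.
rewrite (_ : c * _ = l * (X1 * r) + (a + c) * (X1 * r) - a * (X2 * r)).
  by ring.
by rewrite rec; ring.
Qed.

Lemma Rpol_size_neq0 rho (y : int) : 0 <= y <= (size_of rho)%:Z ->
  Rpol rho (size_of rho) y != 0.
Proof.
move=> gy; apply/eqP=> R0; have := rev_pol_rec (leqnn (size_of rho)) gy.
by rewrite R0 mulr0 subnn /Rpol pol_0 hornerC => /eqP; rewrite oner_eq0.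
Qed.
End ReversedFamily.

(** * Independence on the common grid *)

Section CommonGrid.
Variables (K : fieldType) (F : finite_family K).
Variables (rho rhob : param F) (eta : int).

(** The points x + eta of the grid of rhob with x in the grid of rho, indexed by
    ordinals. *)
Definition shared_nodes : {set 'I_(size_of rhob).+1} :=
  [set y : 'I_(size_of rhob).+1 | (y : nat)%:Z - eta \in grid rho].

Lemma card_shared_nodes :
  #|shared_nodes| = ((size_of rhob).+1 - missing rho rhob eta)%N.
Proof.
rewrite -[in RHS](card_ord (size_of rhob).+1) -(cardsC shared_nodes).
rewrite /missing (_ : [set y | _] = ~: shared_nodes) ?addnK //.
by apply/setP=> y; rewrite !inE.
Qed.

Lemma grid_ord (y : 'I_(size_of rhob).+1) : (y : nat)%:Z \in grid rhob.
Proof. by rewrite inE /= lez_nat -ltnS ltn_ord. Qed.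

Lemma shared_nodes_common (y : 'I_(size_of rhob).+1) :
  y \in shared_nodes -> (y : nat)%:Z - eta \in common_grid rho rhob eta.
Proof.
rewrite inE => gy; rewrite inE; apply/andP; split; first exact: gy.
by rewrite subrK grid_ord.
Qed.

Lemma lam_ord_inj : injective (fun y : 'I_(size_of rhob).+1 => lam rhob (y : nat)%:Z).
Proof.
move=> y z /(lam_inj (grid_ord y) (grid_ord z)) [] yz; exact: val_inj.
Qed.

Lemma Rpol_low_independent (f : nat -> K) :
  (forall x, x \in common_grid rho rhob eta ->
     \sum_(0 <= j < (size_of rhob).+1 - missing rho rhob eta)
        f j * Rpol rhob j (x + eta) = 0) ->
  forall j, (0 <= j < (size_of rhob).+1 - missing rho rhob eta)%N -> f j = 0.
Proof.
move=> sum0 j /=; rewrite -card_shared_nodes; move: j.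
apply: (graded_values_independent (S := shared_nodes) (h := fun=> 1)
          (g := pol rhob) lam_ord_inj) => //.
- by move=> y _; rewrite oner_eq0.
- move=> j; rewrite card_shared_nodes => ltj; apply: pol_degree; lia.
- move=> y /shared_nodes_common /sum0; rewrite subrK card_shared_nodes => s0.
  by rewrite -[RHS]s0; apply: eq_bigr => j _; rewrite mulr1.
Qed.

Lemma Rpol_high_independent (f : nat -> K) :
  (forall x, x \in common_grid rho rhob eta ->
     \sum_(missing rho rhob eta <= j < (size_of rhob).+1)
        f j * Rpol rhob j (x + eta) = 0) ->
  forall j, (missing rho rhob eta <= j < (size_of rhob).+1)%N -> f j = 0.
Proof.
move=> sum0 j /andP[lemj ltjM].
have := graded_values_independent (S := shared_nodes)
  (h := fun y => Rpol rhob (size_of rhob) (y : nat)%:Z)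
  (g := rev_pol rhob) (f := fun k => f (size_of rhob - k)%N) lam_ord_inj.
move=> /(_ #|shared_nodes|) indep.
rewrite -[j](@subKn _ (size_of rhob)) //; apply: indep => //.
- by move=> y _; apply: Rpol_size_neq0; exact: grid_ord.
- move=> k; rewrite card_shared_nodes => ltk; apply: size_rev_pol; lia.
- move=> y /shared_nodes_common /sum0; rewrite subrK card_shared_nodes => s0.
  rewrite -[RHS]s0 big_nat_rev -{4}[missing _ _ _]add0n big_addn.
  rewrite !big_nat; apply: eq_bigr => k /andP[_ ltk].
  rewrite -rev_pol_rec; [|lia|exact: grid_ord].
  have -> : (size_of rhob
      - (0 + ((size_of rhob).+1 - missing rho rhob eta) - k.+1)
      = k + missing rho rhob eta)%N by lia.
  by [].
- rewrite card_shared_nodes; lia.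
Qed.

(** The polynomials R_(i+1), R_i, R_(i-1), R_(i-2) of rhob are independent on the
    common grid; coefficients at indices outside 0, ..., [size_of rhob] are
    assumed to vanish. *)
Lemma Rpol_window_independent (i : nat) (e1 e2 e3 e4 : K) :
  missing rho rhob eta = 0%N \/
    ((missing rho rhob eta).*2 + 2 <= size_of rhob)%N ->
  (i <= (size_of rhob).+1)%N ->
  ((size_of rhob <= i)%N -> e1 = 0) -> ((size_of rhob < i)%N -> e2 = 0) ->
  ((i < 1)%N -> e3 = 0) -> ((i < 2)%N -> e4 = 0) ->
  (forall x, x \in common_grid rho rhob eta ->
     e1 * Rpol rhob i.+1 (x + eta) + e2 * Rpol rhob i (x + eta)
     + e3 * Rpol rhob i.-1 (x + eta) + e4 * Rpol rhob i.-2 (x + eta) = 0) ->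
  [/\ e1 = 0, e2 = 0, e3 = 0 & e4 = 0].
Proof.
set m := missing _ _ _; set M := size_of rhob => large leiM h1 h2 h3 h4 rel.
(* The window lies below N' - m in the first case, above m in the second. *)
have [low|high] := boolP ((0 < m) && (i.+1 < M.+1 - m))%N.
- apply: (window_coefs_eq0 (P := fun x => x \in common_grid rho rhob eta)
     (u := fun j x => Rpol rhob j (x + eta)) Rpol_low_independent _ _ _ _ h3 h4 rel);
     rewrite -/m -/M => out.
  + exfalso; move: low out; clear; lia.
  + exfalso; move: low out; clear; lia.
  + exfalso; move: low out; clear; lia.
  + exfalso; move: low out; clear; lia.
- apply: (window_coefs_eq0 (P := fun x => x \in common_grid rho rhob eta)
     (u := fun j x => Rpol rhob j (x + eta)) Rpol_high_independent _ _ _ _ h3 h4 rel);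
     rewrite -/m -/M => out.
  + by apply: h1; move: high out large; clear; lia.
  + by apply: h2; move: high out large; clear; lia.
  + by apply: h3; move: high out large leiM; clear; lia.
  + by apply: h4; move: high out large leiM; clear; lia.
Qed.
End CommonGrid.

(** * Comparison of coefficients *)

Section Coefficients.
Variables (K : fieldType) (F : finite_family K).
Variables (rho rhob : param F) (zeta xi : K).
Local Notation N := (size_of rho).
Local Notation M := (size_of rhob).
Implicit Types (phi psi : nat -> K) (i : nat).

(** The coefficients of R_(i+1), R_i, R_(i-1) and R_(i-2) of rhob, in this order,
    in the recurrence for R_i(x; rho). At i = 0 the truncated predecessors occur
    only with a factor coefC 0 = 0 or psi 0, and psi 0 = 0 in every use. *)
Definition A2_relations phi psi i : Prop :=
  [/\ zeta * coefA rhob i * phi i = coefA rho i * phi i.+1,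
      (zeta * coefY rhob i - coefY rho i - xi) * phi i
        + zeta * coefA rhob i.-1 * psi i = coefA rho i * psi i.+1,
      zeta * Defs.coefC rhob i * phi i
        + (zeta * coefY rhob i.-1 - coefY rho i - xi) * psi i
        = Defs.coefC rho i * phi i.-1 &
      zeta * Defs.coefC rhob i.-1 * psi i = Defs.coefC rho i * psi i.-1].

Lemma Rpol_rec (r : param F) i (x : int) :
  (i <= size_of r)%N -> x \in grid r ->
  lam r x * Rpol r i x = coefA r i * Rpol r i.+1 x
    + coefY r i * Rpol r i x + Defs.coefC r i * Rpol r i.-1 x.
Proof. by move=> lei gx; rewrite /Rpol (pol_rec lei gx) /coefY mulNr. Qed.

Lemma coefXE (r : param F) i :
  Defs.coefX r i = coefA r i.-1 * Defs.coefC r i.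
Proof. by case: i => //=; rewrite coefC_0 mulr0. Qed.

Lemma A2_contiguity_relations eta lamp phi psi :
  (N <= M.+1)%N ->
  missing rho rhob eta = 0%N \/ ((missing rho rhob eta).*2 + 2 <= M)%N ->
  (forall x : int, x \in common_grid rho rhob eta ->
     lam rho x = zeta * lam rhob (x + eta) - xi) ->
  A2_contiguity rho rhob eta lamp phi psi ->
  forall i, (i <= N)%N -> A2_relations phi psi i.
Proof.
move=> sizes large affine [psi0 _ phi_out rel] i leiN.
have A_N j : (N <= j <= N)%N -> coefA rho j = 0.
  by rewrite -eqn_leq => /eqP <-; rewrite coefA_N.
have a_M j : (M <= j <= M)%N -> coefA rhob j = 0.
  by rewrite -eqn_leq => /eqP <-; rewrite coefA_N.
have leiM : (i <= M.+1)%N by exact: leq_trans sizes.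
have phiM : (M < i)%N -> phi i = 0 by move=> ltMi; rewrite phi_out // ltMi.
(* The coefficient of R_(N'+1), which does not belong to the family of rhob. *)
have AphiS : (M <= i)%N -> coefA rho i * phi i.+1 = 0.
  move=> leMi; have [ltiN|leNi] := ltnP i N.
    by rewrite phi_out ?mulr0 // ltnS leMi.
  by rewrite A_N ?mul0r // leNi.
have [] := @Rpol_window_independent _ _ rho rhob eta i
   (zeta * coefA rhob i * phi i - coefA rho i * phi i.+1)
   ((zeta * coefY rhob i - coefY rho i - xi) * phi i
        + zeta * coefA rhob i.-1 * psi i - coefA rho i * psi i.+1)
   (zeta * Defs.coefC rhob i * phi i
        + (zeta * coefY rhob i.-1 - coefY rho i - xi) * psi i
        - Defs.coefC rho i * phi i.-1)
   (zeta * Defs.coefC rhob i.-1 * psi i - Defs.coefC rho i * psi i.-1)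
   large leiM.
- move=> leMi; rewrite AphiS //; have [ltMi|leiM'] := ltnP M i.
    by rewrite phiM ?mulr0 ?subr0.
  by rewrite a_M ?leMi // mulr0 mul0r subr0.
- move=> ltMi; have Ei : i = M.+1 by lia.
  rewrite phiM // Ei coefA_N A_N; last by lia.
  by rewrite !(mulr0, mul0r) subr0 addr0.
- case: i {leiN leiM phiM AphiS} => // _.
  by rewrite psi0 !coefC_0 !(mulr0, mul0r) addr0 subr0.
- by case: i {leiN leiM phiM AphiS} => [|[|//]] _;
    rewrite /= psi0 !coefC_0 !(mulr0, mul0r) subr0.
- move=> x Gx; have /andP[gx gxb] := Gx.
  have Hi := rel i x leiN Gx.
  have HA : coefA rho i * (lamp x * Rpol rho i.+1 x) =
      coefA rho i * (phi i.+1 * Rpol rhob i.+1 (x + eta)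
                     + psi i.+1 * Rpol rhob i (x + eta)).
    have [ltiN|leNi] := ltnP i N; first by rewrite rel.
    by rewrite A_N ?mul0r // leNi.
  have HC := rel i.-1 x (leq_trans (leq_pred i) leiN) Gx.
  have Rphi : phi i * (lam rhob (x + eta) * Rpol rhob i (x + eta)) =
      phi i * (coefA rhob i * Rpol rhob i.+1 (x + eta)
        + coefY rhob i * Rpol rhob i (x + eta)
        + Defs.coefC rhob i * Rpol rhob i.-1 (x + eta)).
    have [ltMi|leiM'] := ltnP M i; first by rewrite phiM ?mul0r.
    by rewrite Rpol_rec.
  have Rpsi : psi i * (lam rhob (x + eta) * Rpol rhob i.-1 (x + eta)) =
      psi i * (coefA rhob i.-1 * Rpol rhob i (x + eta)
        + coefY rhob i.-1 * Rpol rhob i.-1 (x + eta)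
        + Defs.coefC rhob i.-1 * Rpol rhob i.-2 (x + eta)).
    case: i leiM {leiN phiM AphiS Hi HA HC Rphi} => [|i leiM] .
      by rewrite psi0 !mul0r.
    by rewrite Rpol_rec.
  have Rrho := Rpol_rec leiN gx.
  have aff := affine x Gx.
  transitivity (zeta * (phi i * (lam rhob (x + eta) * Rpol rhob i (x + eta)))
    + zeta * (psi i * (lam rhob (x + eta) * Rpol rhob i.-1 (x + eta)))
    - (coefY rho i + xi) * (lamp x * Rpol rho i x)
    - coefA rho i * (lamp x * Rpol rho i.+1 x)
    - Defs.coefC rho i * (lamp x * Rpol rho i.-1 x)).
    by rewrite Hi HA HC Rphi Rpsi; ring.
  transitivity (zeta * lam rhob (x + eta) * (phi i * Rpol rhob i (x + eta)
      + psi i * Rpol rhob i.-1 (x + eta)) - xi * (lamp x * Rpol rho i x)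
    - lamp x * (coefA rho i * Rpol rho i.+1 x
      + coefY rho i * Rpol rho i x + Defs.coefC rho i * Rpol rho i.-1 x)).
    by ring.
  by rewrite -Hi -Rrho aff; ring.
- by move=> /subr0_eq E1 /subr0_eq E2 /subr0_eq E3 /subr0_eq E4.
Qed.

(** * The coefficients and the constraints *)

Local Notation Phi0 := (A2_Phi0 rho rhob zeta).
Local Notation Phim := (A2_Phim rho rhob zeta xi).

Lemma A2_Phi0_0 : Phi0 0 = 1.
Proof. by rewrite /A2_Phi0 big_nil mulr1. Qed.

Lemma A2_Phi0S i : Phi0 i.+1 = zeta * (coefA rhob i / coefA rho i) * Phi0 i.
Proof. by rewrite /A2_Phi0 exprS big_nat_recr //=; ring. Qed.

Lemma A2_Phim1 : Phim 1 = 1 - (zeta * coefA rhob 0 + xi) / coefA rho 0.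
Proof. by rewrite /A2_Phim big_geq // expr0 invr1 mul1r mulr1. Qed.

Lemma A2_PhimSS i :
  Phim i.+2 = zeta^-1 * (Defs.coefC rho i.+2 / Defs.coefC rhob i.+1) * Phim i.+1.
Proof. by rewrite /A2_Phim exprS invfM big_nat_recr //=; ring. Qed.

(** The equations determine the coefficients up to the factor phi 0. When the
    grid of rhob is a single point, zeta may be 0, but then i <= 1 and no power of
    zeta is inverted. *)
Lemma A2_relations_coefficients phi psi :
  (N <= M.+1)%N -> zeta != 0 \/ M = 0%N -> psi 0 = 0 ->
  (forall i, (i <= N)%N -> A2_relations phi psi i) ->
  forall i, (i <= N)%N -> phi i = phi 0 * Phi0 i /\ psi i = phi 0 * Phim i.
Proof.
move=> sizes zeta0 psi0 rels; elim=> [_|i IHi ltiN].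
  by rewrite A2_Phi0_0 mulr1 psi0 mulr0.
have [phi_i psi_i] := IHi (ltnW ltiN).
have Ai0 := coefA_neq0 ltiN.
have [E1 E2 _ _] := rels i (ltnW ltiN); split.
  by apply: (mulfI Ai0); rewrite -E1 phi_i A2_Phi0S; field.
case: i => [|i] in ltiN phi_i psi_i Ai0 E1 E2 IHi *.
  apply: (mulfI Ai0); rewrite -E2 psi0 A2_Phim1 /coefY !coefC_0.
  by field.
have E4 : zeta * Defs.coefC rhob i.+1 * psi i.+2 = Defs.coefC rho i.+2 * psi i.+1.
  by have [] := rels i.+2 ltiN.
rewrite psi_i in E4; rewrite A2_PhimSS.
have z0 : zeta != 0 by case: zeta0 => // M0; move: ltiN; rewrite M0 in sizes; lia.
have c0 : Defs.coefC rhob i.+1 != 0 by apply: coefC_neq0; lia.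
apply: (mulfI (mulf_neq0 z0 c0)); rewrite E4; field.
by rewrite z0 c0.
Qed.

(** The factor w_i which turns the coefficients into the terms of the constrained
    expressions. *)
Definition A2_weight i : K :=
  zeta ^+ i * \prod_(1 <= k < i.+1) (Defs.coefC rhob k / Defs.coefC rho k).

Lemma A2_weightS i : A2_weight i.+1 =
  zeta * (Defs.coefC rhob i.+1 / Defs.coefC rho i.+1) * A2_weight i.
Proof. by rewrite /A2_weight exprS big_nat_recr //=; ring. Qed.

Lemma A2_weight0 : A2_weight 0 = 1.
Proof. by rewrite /A2_weight big_nil mulr1. Qed.

Lemma A2_weight_neq0 i : zeta != 0 \/ M = 0%N ->
  (i <= N)%N -> (i <= M)%N -> A2_weight i != 0.
Proof.
move=> zeta0; elim: i => [|i IHi] leN leM; first by rewrite A2_weight0 oner_eq0.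
have z0 : zeta != 0 by case: zeta0 => // M0; rewrite M0 in leM.
rewrite A2_weightS mulf_neq0 ?IHi ?(ltnW leN) ?(ltnW leM) //.
by rewrite !mulf_neq0 ?invr_eq0 ?coefC_neq0.
Qed.

(** The prefactor of the constrained expressions is Phi0_i w_i. *)
Lemma A2_prodE i :
  zeta ^+ (2 * i) * \prod_(1 <= k < i.+1) (Defs.coefX rhob k / Defs.coefX rho k)
  = Phi0 i * A2_weight i.
Proof.
elim: i => [|i IHi].
  by rewrite muln0 !big_geq // A2_Phi0_0 A2_weight0.
rewrite A2_Phi0S A2_weightS mulnS exprD big_nat_recr //=.
transitivity (zeta ^+ 2 * (coefA rhob i * Defs.coefC rhob i.+1
   / (coefA rho i * Defs.coefC rho i.+1)) * (Phi0 i * A2_weight i)).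
  by rewrite -IHi; ring.
by rewrite invfM; ring.
Qed.

(** The common value of the constrained expressions. *)
Definition A2_kappa : K := Phim 1 / Defs.coefC rho 1.

Lemma A2_PhimS_weight i : zeta != 0 \/ M = 0%N -> (i < N)%N -> (i <= M)%N ->
  Phim i.+1 * A2_weight i = Defs.coefC rho i.+1 * A2_kappa.
Proof.
move=> zeta0; elim: i => [|i IHi] ltN leM.
  by rewrite A2_weight0 mulr1 /A2_kappa mulrC divfK // coefC_neq0.
have z0 : zeta != 0 by case: zeta0 => // M0; rewrite M0 in leM.
rewrite A2_PhimSS A2_weightS.
have c0 : Defs.coefC rhob i.+1 != 0 by rewrite coefC_neq0.
have C0 : Defs.coefC rho i.+1 != 0 by apply: coefC_neq0; apply: ltnW.
transitivity (Defs.coefC rho i.+2 / Defs.coefC rho i.+1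
              * (Phim i.+1 * A2_weight i)).
  by field; rewrite z0 c0 C0.
rewrite IHi ?(ltnW ltN) ?(ltnW leM) // mulrA divfK //.
Qed.

Lemma A2_Phim_weight i : zeta != 0 \/ M = 0%N -> (i <= N)%N -> (i <= M)%N ->
  Phim i * A2_weight i = zeta * Defs.coefC rhob i * A2_kappa.
Proof.
case: i => [|i] zeta0 leN leM; first by rewrite coefC_0 mulr0 !mul0r.
have C0 : Defs.coefC rho i.+1 != 0 by rewrite coefC_neq0.
rewrite A2_weightS.
transitivity (zeta * (Defs.coefC rhob i.+1 / Defs.coefC rho i.+1)
              * (Phim i.+1 * A2_weight i)); first by ring.
by rewrite A2_PhimS_weight ?(ltnW leM) //; field.
Qed.

(** The second equation at i is the first constraint at i. At i = N the terms
    A_N Phim_(N+1) and X_(N+1) vanish because A_N = 0. *)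
Lemma A2_expr1P i : zeta != 0 \/ M = 0%N -> (i <= N)%N -> (i <= M)%N ->
  A2_den1 rho rhob zeta i != 0 ->
  ((zeta * coefY rhob i - coefY rho i - xi) * Phi0 i
     + zeta * coefA rhob i.-1 * Phim i = coefA rho i * Phim i.+1)
  <-> A2_expr1 rho rhob zeta xi i = A2_kappa.
Proof.
move=> zeta0 leN leM den0.
have w0 := A2_weight_neq0 zeta0 leN leM.
have -> : A2_expr1 rho rhob zeta xi i =
    (zeta * coefY rhob i - coefY rho i - xi) * (Phi0 i * A2_weight i)
    / A2_den1 rho rhob zeta i.
  by rewrite -A2_prodE /A2_expr1; ring.
have EA : coefA rho i * (Phim i.+1 * A2_weight i)
    = Defs.coefX rho i.+1 * A2_kappa.
  have [ltiN|leNi] := ltnP i N; first by rewrite A2_PhimS_weight // mulrA.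
  by rewrite (_ : i = N) /= ?coefA_N ?mul0r //; apply/eqP; rewrite eqn_leq leN.
have EB : zeta * coefA rhob i.-1 * (Phim i * A2_weight i)
    = zeta ^+ 2 * Defs.coefX rhob i * A2_kappa.
  by rewrite A2_Phim_weight // coefXE; ring.
have EX : A2_kappa * A2_den1 rho rhob zeta i
   = coefA rho i * (Phim i.+1 * A2_weight i)
     - zeta * coefA rhob i.-1 * (Phim i * A2_weight i).
  by rewrite EA EB /A2_den1; ring.
split=> [E|/(canRL (divfK den0)) E].
  apply: (canLR (mulfK den0)); rewrite EX [in RHS]mulrA -E; ring.
apply: (mulIf w0).
transitivity ((zeta * coefY rhob i - coefY rho i - xi) * (Phi0 i * A2_weight i)
  + zeta * coefA rhob i.-1 * (Phim i * A2_weight i)); first by ring.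
by rewrite E EX; ring.
Qed.

(** The third equation at i + 1 is the second constraint at i. *)
Lemma A2_expr2P i : zeta != 0 \/ M = 0%N -> (i < N)%N -> (i <= M)%N ->
  A2_den2 rho rhob zeta xi i != 0 ->
  (zeta * Defs.coefC rhob i.+1 * Phi0 i.+1
     + (zeta * coefY rhob i - coefY rho i.+1 - xi) * Phim i.+1
     = Defs.coefC rho i.+1 * Phi0 i)
  <-> A2_expr2 rho rhob zeta xi i = A2_kappa.
Proof.
move=> zeta0 ltN leM den0.
have w0 := A2_weight_neq0 zeta0 (ltnW ltN) leM.
have A0 := coefA_neq0 ltN.
have X0 : Defs.coefX rho i.+1 != 0 by exact: coefAC_neq0.
have den0X := mulf_neq0 den0 X0.
have -> : A2_expr2 rho rhob zeta xi i =
    (Defs.coefX rho i.+1 - zeta ^+ 2 * Defs.coefX rhob i.+1)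
    * (Phi0 i * A2_weight i)
    / (A2_den2 rho rhob zeta xi i * Defs.coefX rho i.+1).
  by rewrite -A2_prodE /A2_expr2; ring.
have EK : A2_kappa * (A2_den2 rho rhob zeta xi i * Defs.coefX rho i.+1)
  = A2_den2 rho rhob zeta xi i * coefA rho i * (Phim i.+1 * A2_weight i).
  by rewrite A2_PhimS_weight //=; ring.
have EP : (Defs.coefX rho i.+1 - zeta ^+ 2 * Defs.coefX rhob i.+1)
    * (Phi0 i * A2_weight i) = coefA rho i * A2_weight i *
    (Defs.coefC rho i.+1 * Phi0 i - zeta * Defs.coefC rhob i.+1 * Phi0 i.+1).
  by rewrite A2_Phi0S /=; field.
split=> [E|/(canRL (divfK den0X))].
  by apply: (canLR (mulfK den0X)); rewrite EK EP -E /A2_den2; ring.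
rewrite EK EP => E; apply: (mulfI (mulf_neq0 A0 w0)).
transitivity (coefA rho i * A2_weight i * (zeta * Defs.coefC rhob i.+1 * Phi0 i.+1)
  + A2_den2 rho rhob zeta xi i * coefA rho i * (Phim i.+1 * A2_weight i)).
  by rewrite /A2_den2; ring.
by rewrite -E; ring.
Qed.

Lemma A2_relations_constraints :
  zeta != 0 \/ M = 0%N -> (N <= M.+1)%N -> A2_generic rho rhob zeta xi ->
  (forall i, (i <= N)%N -> A2_relations Phi0 Phim i) ->
  A2_constraints rho rhob zeta xi.
Proof.
move=> zeta0 sizes [gen1 gen2] rels; exists A2_kappa; split=> i Hi.
  have /and3P[_ leN leM] := Hi.
  by apply/A2_expr1P; rewrite ?gen1 //; have [] := rels i leN.
have leM : (i <= M)%N by rewrite -ltnS (leq_trans Hi).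
by apply/A2_expr2P; rewrite ?gen2 //; have [] := rels i.+1 Hi.
Qed.

(** Only the indices i < N are covered. If N is smaller than the size of rhob,
    the first equation at i = N, which reads zeta a_N Phi0_N = 0, is false for
    nonzero zeta. *)
Lemma A2_constraints_relations :
  zeta != 0 \/ M = 0%N -> (N <= M.+1)%N -> A2_generic rho rhob zeta xi ->
  A2_constraints rho rhob zeta xi ->
  forall i, (i < N)%N -> A2_relations Phi0 Phim i.
Proof.
move=> zeta0 sizes [gen1 gen2] [kappa [con1 con2]] i ltN.
have N0 : (0 < N)%N by exact: leq_trans ltN.
have r1 j : (j < N)%N -> A2_range1 rho rhob j.
  by move=> ltj; rewrite /A2_range1 N0 ltnW //= -ltnS (leq_trans ltj).
have leM j : (j < N)%N -> (j <= M)%N by case/r1/and3P.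
(* The constant is read off from the first expression at i = 0. *)
have Ekappa : kappa = A2_kappa.
  rewrite -(con1 0%N (r1 _ N0)); apply/(A2_expr1P zeta0) => //.
    exact: gen1 (r1 _ N0).
  rewrite A2_Phi0_0 A2_Phim1 mulr0 addr0 /coefY !coefC_0.
  by field; exact: coefA_neq0.
rewrite {kappa}Ekappa in con1 con2.
split.
- by rewrite A2_Phi0S; field; exact: coefA_neq0.
- by apply/(A2_expr1P zeta0); rewrite ?(ltnW ltN, leM, gen1, con1, r1).
- case: i ltN => [|i] ltN; first by rewrite /= !coefC_0 !(mulr0, mul0r) addr0.
  have ltN' := ltnW ltN.
  by apply/(A2_expr2P zeta0); rewrite ?(leM, gen2, con2).
- case: i ltN => [|[|i]] ltN; rewrite ?[_.-1]/=.
  + by rewrite coefC_0 !(mulr0, mul0r).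
  + by rewrite coefC_0 !(mulr0, mul0r).
  have z0 : zeta != 0.
    by case: zeta0 => // M0; have := leM _ ltN; rewrite M0.
  have c0 : Defs.coefC rhob i.+1 != 0 by rewrite coefC_neq0 //= ltnW // leM.
  by rewrite A2_PhimSS; field; rewrite z0 c0.
Qed.

Lemma A2_relations_contiguity eta (x : int) :
  (N <= M.+1)%N -> x \in common_grid rho rhob eta ->
  lam rho x = zeta * lam rhob (x + eta) - xi ->
  (forall i, (i < N)%N -> A2_relations Phi0 Phim i) ->
  forall i, (i <= N)%N -> Rpol rho i x =
    Phi0 i * Rpol rhob i (x + eta) + Phim i * Rpol rhob i.-1 (x + eta).
Proof.
move=> sizes Gx aff rels; have /andP[gx gxb] := Gx.
suff step i : (i <= N)%N ->
  (Rpol rho i x =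
    Phi0 i * Rpol rhob i (x + eta) + Phim i * Rpol rhob i.-1 (x + eta)) /\
  (Rpol rho i.-1 x =
    Phi0 i.-1 * Rpol rhob i.-1 (x + eta) + Phim i.-1 * Rpol rhob i.-2 (x + eta)).
  by move=> i /step[].
elim: i => [|i IHi] ltN.
  by rewrite /= A2_Phi0_0 mul0r addr0 mul1r /Rpol !pol_0 !hornerC.
have leN := ltnW ltN; have leM : (i <= M)%N by rewrite -ltnS (leq_trans ltN).
have [Hi Hi1] := IHi leN; split=> //.
have [E1 E2 E3 E4] := rels i ltN.
apply: (mulfI (coefA_neq0 ltN)).
have Rrho := Rpol_rec leN gx.
have Rphi := Rpol_rec leM gxb.
have Rpsi : Phim i * (lam rhob (x + eta) * Rpol rhob i.-1 (x + eta)) =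
      Phim i * (coefA rhob i.-1 * Rpol rhob i (x + eta)
        + coefY rhob i.-1 * Rpol rhob i.-1 (x + eta)
        + Defs.coefC rhob i.-1 * Rpol rhob i.-2 (x + eta)).
  case: i leM {ltN leN IHi Hi Hi1 E1 E2 E3 E4 Rrho Rphi} => [|i] leM.
    by rewrite !mul0r.
  by rewrite Rpol_rec // ltnW.
transitivity (coefA rho i * Phi0 i.+1 * Rpol rhob i.+1 (x + eta)
   + coefA rho i * Phim i.+1 * Rpol rhob i (x + eta)); last by ring.
rewrite -E1 -E2.
transitivity (lam rho x * Rpol rho i x - coefY rho i * Rpol rho i x
  - Defs.coefC rho i * Rpol rho i.-1 x); first by rewrite Rrho; ring.
rewrite Hi Hi1 aff.
transitivity (zeta * Phi0 i * (lam rhob (x + eta) * Rpol rhob i (x + eta))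
  + zeta * (Phim i * (lam rhob (x + eta) * Rpol rhob i.-1 (x + eta)))
  - (xi + coefY rho i) * (Phi0 i * Rpol rhob i (x + eta)
       + Phim i * Rpol rhob i.-1 (x + eta))
  - (Defs.coefC rho i * Phi0 i.-1) * Rpol rhob i.-1 (x + eta)
  - (Defs.coefC rho i * Phim i.-1) * Rpol rhob i.-2 (x + eta)); first by ring.
by rewrite -E3 -E4 Rphi Rpsi; ring.
Qed.

Lemma A2_relations_scale (c : K) phi psi phi' psi' : c != 0 ->
  (forall i, (i <= N)%N -> phi i = c * phi' i /\ psi i = c * psi' i) ->
  (forall i, (i <= N)%N -> A2_relations phi psi i) ->
  forall i, (i <= N)%N -> A2_relations phi' psi' i.
Proof.
move=> c0 scale rels i leN; have [E1 E2 E3 E4] := rels i leN.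
have [phi_i psi_i] := scale i leN.
have [phi_p psi_p] := scale i.-1 (leq_trans (leq_pred i) leN).
have [Aphi Apsi] : coefA rho i * phi i.+1 = c * (coefA rho i * phi' i.+1) /\
                   coefA rho i * psi i.+1 = c * (coefA rho i * psi' i.+1).
  have [ltN|geN] := ltnP i N.
    by have [-> ->] := scale _ ltN; rewrite !(mulrCA c).
  by rewrite (_ : i = N) ?coefA_N ?mul0r ?mulr0 //; apply/eqP; rewrite eqn_leq leN.
split; apply: (mulfI c0).
- by rewrite -Aphi -E1 phi_i; ring.
- by rewrite -Apsi -E2 phi_i psi_i; ring.
- by rewrite [RHS]mulrCA -phi_p -E3 phi_i psi_i; ring.
- by rewrite [RHS]mulrCA -psi_p -E4 psi_i; ring.
Qed.

(** If the grid of rhob has more than one point, then so has the common grid, and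
    zeta = 0 would make lambda constant there. *)
Lemma zeta_neq0_or_size0 eta :
  missing rho rhob eta = 0%N \/ ((missing rho rhob eta).*2 + 2 <= M)%N ->
  (forall x : int, x \in common_grid rho rhob eta ->
     lam rho x = zeta * lam rhob (x + eta) - xi) ->
  zeta != 0 \/ M = 0%N.
Proof.
move=> large affine.
have [->|M0] := eqVneq M 0%N; [by right | left; apply/eqP=> z0].
have : (1 < #|shared_nodes rho rhob eta|)%N.
  by rewrite card_shared_nodes; lia.
case/card_gt1P=> y [z [Sy Sz yz]]; case/eqP: yz.
have Gy := shared_nodes_common Sy; have Gz := shared_nodes_common Sz.
have /andP[gy _] := Gy; have /andP[gz _] := Gz.
have /addIr [] : (y : nat)%:Z - eta = (z : nat)%:Z - eta.
  by apply: (lam_inj gy gz); rewrite !affine // z0 !mul0r.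
exact: val_inj.
Qed.
End Coefficients.

(** * The contiguity relation *)

Theorem proposition2p2 (K : fieldType) (F : finite_family K)
  (rho rhob : param F) (eta : int) (zeta xi : K)
  (eta_shift : [\/ eta = 0, eta = 1 | eta = -1])
  (sizes : (size_of rho <= (size_of rhob).+1)%N)
  (large : missing rho rhob eta = 0%N \/
           ((missing rho rhob eta).*2 + 2 <= size_of rhob)%N)
  (lam_affine : forall x : int, x \in common_grid rho rhob eta ->
     lam rho x = zeta * lam rhob (x + eta) - xi)
  (generic : A2_generic rho rhob zeta xi) :
  ((exists (lamp : int -> K) (Phi0 Phim : nat -> K),
      A2_contiguity rho rhob eta lamp Phi0 Phim)
   <-> A2_constraints rho rhob zeta xi)
  /\
  (forall (lamp : int -> K) (Phi0 Phim : nat -> K),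
     A2_contiguity rho rhob eta lamp Phi0 Phim
     <-> (A2_coefficients rho rhob eta zeta xi lamp Phi0 Phim
          /\ A2_constraints rho rhob zeta xi)).
Proof.
have zeta0 := zeta_neq0_or_size0 large lam_affine.
have necessary lamp phi psi : A2_contiguity rho rhob eta lamp phi psi ->
    A2_coefficients rho rhob eta zeta xi lamp phi psi
    /\ A2_constraints rho rhob zeta xi.
  move=> contig; have [psi0 phi0 _ rel] := contig.
  have rels := A2_contiguity_relations sizes large lam_affine contig.
  have coefs := A2_relations_coefficients sizes zeta0 psi0 rels.
  split; last first.
    apply: A2_relations_constraints => //.
    exact: A2_relations_scale phi0 coefs rels.
  exists (phi 0) => //; split=> [x Gx|i /coefs[]|i /coefs[]] //.
  have := rel 0%N x (leq0n _) Gx.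
  by rewrite psi0 mul0r addr0 /Rpol !pol_0 !hornerC !mulr1.
have sufficient lamp phi psi :
    A2_coefficients rho rhob eta zeta xi lamp phi psi ->
    A2_constraints rho rhob zeta xi ->
    A2_contiguity rho rhob eta lamp phi psi.
  move=> [c c0 [lampE phiE psiE]] constraints; split.
  - by rewrite psiE // mulr0.
  - by rewrite phiE // A2_Phi0_0 mulr1.
  - (* For i > N' the product Phi0_i contains the factor a_N' = 0. *)
    move=> i /andP[ltMi leiN]; rewrite phiE // /A2_Phi0.
    rewrite (bigD1_seq (size_of rhob)) ?mem_index_iota ?iota_uniq //=.
    by rewrite coefA_N !mul0r !mulr0.
  - move=> i x leiN Gx; rewrite lampE // phiE // psiE // mulr1.
    rewrite (A2_relations_contiguity sizes Gx (lam_affine x Gx)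
               (A2_constraints_relations zeta0 sizes generic constraints) leiN).
    by ring.
split=> [|lamp phi psi]; last first.
  by split=> [/necessary//|[coefs constraints]]; exact: sufficient.
split=> [[lamp [phi [psi /necessary[]]]] //|constraints].
exists (fun=> 1), (A2_Phi0 rho rhob zeta), (A2_Phim rho rhob zeta xi).
apply: sufficient => //; exists 1; first exact: oner_neq0.
by split=> *; rewrite mul1r.
Qed.
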